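(* Let $K\subseteq\mathbf{R}^n$ be a nonempty closed convex set and let $f=(f_1,\dots,f_s):\mathbf{R}^n\to\mathbf{R}^s$ be a vector polynomial with $\deg f_i=d_i\ge 1$ for $i=1,\dots,s$. If $SOL^{w}(K_\infty,f^\infty)=\{0\}$, then $\mathrm{WVCP}(K_\infty,\nabla f^\infty)$ is of type $R_0$. Conversely, if $\mathrm{WVCP}(K_\infty,\nabla f^\infty)$ is of type $R_0$, then $\mathrm{PVOP}(K,f)$ is strongly regular.
   Context: $\mathbf{R}^s_+$ is the nonnegative orthant. For a nonempty closed set $C\subseteq\mathbf{R}^n$ and a vector polynomial $h:\mathbf{R}^n\to\mathbf{R}^s$, $\mathrm{PVOP}(C,h)$ is the problem of minimizing $h$ over $C$ with respect to $\mathbf{R}^s_+$, and $SOL^{w}(C,h)$ (weak Pareto efficient solutions) is the set of $x^*\in C$ such that $h(x)-h(x^* )\notin-\mathrm{int}\,\mathbf{R}^s_+$ for all $x\in C$. The asymptotic cone of $K$ is $K_\infty=\{v\in\mathbf{R}^n:\text{ there exist } t_k\to+\infty \text{ and } x_k\in K \text{ with } x_k/t_k\to v\}$. For a vector polynomial $p=(p_1,\dots,p_s)$ with $\deg p_i=d_i$, $p^\infty=(p_1^\infty,\dots,p_s^\infty)$ where $p_i^\infty(x)=\lim_{\lambda\to+\infty}p_i(\lambda x)/\lambda^{d_i}$. $\mathrm{PVOP}(K,f)$ is strongly regular if $SOL^{w}(K_\infty,f^\infty)$ is bounded (the empty set counts as bounded). Let $L(\mathbf{R}^n,\mathbf{R}^s)$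 be the space of linear operators from $\mathbf{R}^n$ to $\mathbf{R}^s$, with $\langle v,x\rangle\in\mathbf{R}^s$ denoting the value of $v$ at $x$. Write $\nabla f^\infty=(\nabla f_1^\infty,\dots,\nabla f_s^\infty)$, so $\langle\nabla f^\infty(x),y\rangle=(\langle\nabla f_1^\infty(x),y\rangle,\dots,\langle\nabla f_s^\infty(x),y\rangle)$. The weak dual cone of $K_\infty$ is $(K_\infty)^{w+}_{\mathbf{R}^s_+}=\{v\in L(\mathbf{R}^n,\mathbf{R}^s):\langle v,x\rangle\notin-\mathrm{int}\,\mathbf{R}^s_+\ \forall x\in K_\infty\}$. The weak vector complementarity problem $\mathrm{WVCP}(K_\infty,\nabla f^\infty)$ is: find $x\in K_\infty$ such that $\nabla f^\infty(x)\in(K_\infty)^{w+}_{\mathbf{R}^s_+}$ and $\langle\nabla f^\infty(x),x\rangle\notin\mathrm{int}\,\mathbf{R}^s_+$. It is of type $R_0$ if its solution set equals $\{0\}$. *)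

(* Defs.v *)
From HB Require Import structures.
From mathcomp Require Import all_boot all_order all_algebra.
(* The notations of mpoly clash with those of mathcomp-analysis. *)
From mathcomp Require Import -(notations) mpoly.
From mathcomp Require Import all_classical all_reals all_analysis.

Set Implicit Arguments.
Unset Strict Implicit.
Unset Printing Implicit Defensive.

Import Order.TTheory GRing.Theory Num.Theory.
Import numFieldNormedType.Exports.

Local Open Scope classical_set_scope.
Local Open Scope ring_scope.

(* [mmeasure mdeg p] (notation [msize p] in mpoly) is 1 + the total degree of [p] (and 0 for p = 0). *)
Definition pdeg (R : realType) (n : nat) (p : mpoly n R) : nat :=
  (mmeasure mdeg p).-1.

Definition peval (R : realType) (n : nat) (p : mpoly n R)
    (x : 'rV[R]_n) : R :=
  meval (fun j => x ord0 j) p.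

Definition pinfty (R : realType) (n : nat) (p : mpoly n R)
    (x : 'rV[R]_n) : R :=
  lim (peval p (l *: x) / l ^+ pdeg p @[l --> +oo]).

Definition vpinfty (R : realType) (n s : nat) (f : 'I_s -> mpoly n R)
    (x : 'rV[R]_n) : 'rV[R]_s :=
  \row_i pinfty (f i) x.

Definition orthant (R : realType) (s : nat) : set 'rV[R]_s :=
  [set y | forall i, 0 <= y ord0 i].

Definition int_orthant (R : realType) (s : nat) : set 'rV[R]_s :=
  (@orthant R s)°.

Definition opp_int_orthant (R : realType) (s : nat) : set 'rV[R]_s :=
  [set - y | y in @int_orthant R s].

Definition SOLw (R : realType) (n s : nat) (C : set 'rV[R]_n)
    (h : 'rV[R]_n -> 'rV[R]_s) : set 'rV[R]_n :=
  [set x0 | C x0 /\ forall x, C x -> ~ opp_int_orthant (h x - h x0)].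

Definition asym_cone (R : realType) (n : nat) (K : set 'rV[R]_n) :
    set 'rV[R]_n :=
  [set v | exists (t : nat -> R) (x : nat -> 'rV[R]_n),
    [/\ t k @[k --> \oo] --> +oo,
        forall k, K (x k) &
        (t k)^-1 *: x k @[k --> \oo] --> v]].

Definition strongly_regular (R : realType) (n s : nat) (K : set 'rV[R]_n)
    (f : 'I_s -> mpoly n R) : Prop :=
  bounded_set (SOLw (asym_cone K) (vpinfty f)).

Definition grad (R : realType) (n : nat) (g : 'rV[R]_n -> R)
    (x : 'rV[R]_n) : 'rV[R]_n :=
  \row_j 'D_(delta_mx ord0 j) g x.

(* The linear operator y |-> (<grad h_1 x, y>, ..., <grad h_s x, y>);
   vectors are rows, so the gradients are the columns of the matrix. *)
Definition grad_op (R : realType) (n s : nat) (h : 'rV[R]_n -> 'rV[R]_s)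
    (x : 'rV[R]_n) : {linear 'rV[R]_n -> 'rV[R]_s} :=
  mulmxr (\matrix_(j < n, i < s) grad (fun z => h z ord0 i) x ord0 j).

Definition weak_dual_cone (R : realType) (n s : nat) (C : set 'rV[R]_n) :
    set {linear 'rV[R]_n -> 'rV[R]_s} :=
  [set v | forall x, C x -> ~ opp_int_orthant (v x)].

Definition WVCP (R : realType) (n s : nat) (C : set 'rV[R]_n)
    (F : 'rV[R]_n -> {linear 'rV[R]_n -> 'rV[R]_s}) : set 'rV[R]_n :=
  [set x | [/\ C x, weak_dual_cone C (F x) & ~ int_orthant (F x x)]].

Definition type_R0 (R : realType) (n s : nat) (C : set 'rV[R]_n)
    (F : 'rV[R]_n -> {linear 'rV[R]_n -> 'rV[R]_s}) : Prop :=
  WVCP C F = [set 0].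

(* Main.v *)
(* Write g_i for the leading form of f_i, homogeneous of degree d_i >= 1, so
   that f_i^oo = g_i, and C for K_oo, a closed convex cone.
   First-order optimality along the segments from x to x + y and from x to 0
   shows that every weak Pareto point of (C, g) solves the complementarity
   problem; this settles one implication.
   For the other, suppose 0 is the only weak Pareto point and let x <> 0 lie
   in C.
   Every nonzero v in C is strictly dominated by some w in C while 0 is not, so
   some g_i v > 0.  By compactness of the unit sphere of C and homogeneity, the
   sublevel sets of g in C are then bounded.  If x is dominated by z, minimizing
   one component g_i over [C /\ g <= g z] yields a weak Pareto point, i.e. 0,
   so 0 <= g_i z < g_i x.  Hence all g_i x are positive, and by Euler's identity
   <grad g_i x, x> = d_i g_i x so are all <grad g_i x, x>: x is no solution of
   the complementarity problem. *)
Require Import Defs.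
From HB Require Import structures.
From mathcomp Require Import all_boot all_order all_algebra.
From mathcomp Require Import -(notations) mpoly.
From mathcomp Require Import lra.
From mathcomp Require Import all_classical all_reals all_analysis.
Import Order.TTheory GRing.Theory Num.Theory.
Import numFieldNormedType.Exports.
Local Open Scope classical_set_scope.
Local Open Scope ring_scope.

Set Implicit Arguments.
Unset Strict Implicit.

(** * Leading forms of polynomials *)

Section LeadForm.
Context {R : realType} {n : nat}.
Implicit Types (p : mpoly n R) (x v : 'rV[R]_n).

Definition lead_form p x : R :=
  \sum_(m <- msupp p | mdeg m == pdeg p)
    mcoeff m p * \prod_(i < n) x ord0 i ^+ m i.

Lemma prod_scale_exp (m : multinom n) (l : R) x :
  \prod_(i < n) (l *: x) ord0 i ^+ m i
  = l ^+ mdeg m * \prod_(i < n) x ord0 i ^+ m i.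
Proof.
under eq_bigr do rewrite mxE exprMn.
by rewrite big_split /= -expr_sum mpoly.mdegE.
Qed.

Lemma lead_formZ p l x : lead_form p (l *: x) = l ^+ pdeg p * lead_form p x.
Proof.
rewrite mulr_sumr; apply: eq_bigr => m /eqP <-.
by rewrite prod_scale_exp mulrCA.
Qed.

Lemma cvg_inv_pinfty : (l : R)^-1 @[l --> +oo] --> (0 : R).
Proof.
apply/(@gtr0_cvgV0 R R +oo _ id); last exact: cvg_id.
exact: nbhs_pinfty_gt.
Qed.

(* For [l > 0], [p (l x) / l ^ d] is a polynomial in [l^-1] whose constant
   term is the leading form. *)
Lemma pinfty_lead_form p : pinfty p = lead_form p.
Proof.
apply/funext => x; apply: cvg_lim => //.
pose q (t : R) := \sum_(m <- msupp p)
  t ^+ (pdeg p - mdeg m) * (mcoeff m p * \prod_(i < n) x ord0 i ^+ m i).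
have q0 : q 0 = lead_form p x.
  (* At [t = 0] only the terms with [pdeg p - mdeg m = 0] survive. As this subtraction truncates,
     the bound [mdeg m <= pdeg p] is what singles out the top degree. *)
  rewrite /lead_form big_mkcond /q !big_seq; apply: eq_bigr => m mp.
  rewrite expr0n subn_eq0; case: eqP => [->|/eqP ne].
    by rewrite leqnn mul1r.
  rewrite leqNgt ltn_neqAle ne /=.
  suff -> : (mdeg m <= pdeg p)%N by rewrite mul0r.
  by have := mpoly.msize_mdeg_lt mp; rewrite /pdeg; case: mmeasure.
have qc : continuous q.
  move=> t; apply: cvg_big => [|m _]; first exact: add_continuous.
  by apply: cvgM; [exact: exprn_continuous | exact: cvg_cst].
rewrite -q0.
apply: (@cvg_trans _ ((q l^-1) @[l --> +oo])); last first.
  exact: (continuous_cvg _ (qc 0) cvg_inv_pinfty).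
apply: near_eq_cvg; near=> l.
have l0 : l != 0 by apply: lt0r_neq0; near: l; exact: nbhs_pinfty_gt.
rewrite /q /peval mpoly.mevalE mulr_suml !big_seq; apply: eq_bigr => m mp.
rewrite prod_scale_exp.
have mle : (mdeg m <= pdeg p)%N.
  by have := mpoly.msize_mdeg_lt mp; rewrite /pdeg; case: mmeasure.
rewrite -[X in _ / l ^+ X](subnK mle) exprD exprVn.
rewrite [l ^+ mdeg m * _]mulrC [in RHS]mulrA invfM [LHS]mulrC.
by rewrite -[RHS]mulrA [X in _ = _ * X]mulrCA divff ?mulr1 ?expf_neq0.
Unshelve. all: by end_near. Qed.

Lemma differentiable_lead_form p x : differentiable (lead_form p) x.
Proof.
have -> : lead_form p = \sum_(m <- msupp p | mdeg m == pdeg p)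
    (mcoeff m p *: \prod_(i < n) (fun y : 'rV[R]_n => y ord0 i) ^+ m i).
  apply/funext => y; rewrite /lead_form fct_sumE; apply: eq_bigr => m _.
  rewrite -[RHS]/(_ * _) fct_prodE; congr (_ * _); apply: eq_bigr => i _.
  by rewrite exprfctE.
apply: (big_ind (fun g => differentiable g x)) => [|g h|m _].
- exact: differentiable_cst.
- exact: differentiableD.
apply: differentiableZ.
apply: (big_ind (fun g => differentiable g x)) => [|g h|i _].
- exact: differentiable_cst.
- exact: differentiableM.
case: (m i) => [|k]; first exact: differentiable_cst.
exact/differentiableX/differentiable_coord.
Qed.

End LeadForm.

(** * The open orthant and weak Pareto points in coordinates *)

Section Orthant.
Context {R : realType} {s : nat}.
Implicit Types y : 'rV[R]_s.

Lemma int_orthantP y : int_orthant y <-> forall i, 0 < y ord0 i.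
Proof.
split=> [/nbhs_ballP[e /= e0 be] i|y0].
  (* In the max norm, lowering every coordinate by [e / 2] stays inside the ball of radius [e]. *)
  have : orthant (y - const_mx (e / 2)).
    apply: be; rewrite mx_norm_ball /ball_ /= opprB addrC subrK.
    rewrite (@le_lt_trans _ _ (e / 2)) //; last by lra.
    by rewrite /Num.norm /= mx_normrE; apply/bigmax_leP; split => [|ij _];
      rewrite ?mxE ?ger0_norm; lra.
  by move=> /(_ i); rewrite !mxE; lra.
apply: (@filterS _ (nbhs y) _ [set z : 'rV[R]_s | forall i, 0 < z ord0 i]).
  by move=> z z0 i; exact: ltW.
apply: (@filter_forall _ _ (fun i (z : 'rV[R]_s) => 0 < z ord0 i) (nbhs y) _).
move=> i.
exact: (cvgr_gt _ (@coord_continuous R 1 s ord0 i y)).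
Qed.

Lemma opp_int_orthantP y : opp_int_orthant y <-> forall i, y ord0 i < 0.
Proof.
split=> [[z /int_orthantP z0 <-] i|y0]; first by rewrite mxE oppr_lt0.
exists (- y); last by rewrite opprK.
by apply/int_orthantP => i; rewrite mxE oppr_gt0.
Qed.

Lemma SOLwP {n : nat} (C : set 'rV[R]_n) (h : 'rV[R]_n -> 'rV[R]_s) x0 :
  SOLw C h x0 <->
  C x0 /\ forall x, C x -> exists i, h x0 ord0 i <= h x ord0 i.
Proof.
split=> -[Cx0 opt]; split => // x Cx.
  apply/not_existsP => lt; apply: (opt x Cx); apply/opp_int_orthantP => i.
  by rewrite !mxE subr_lt0 ltNge; apply/negP/lt.
have [i hi] := opt x Cx => /opp_int_orthantP/(_ i).
by rewrite !mxE subr_lt0 ltNge hi.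
Qed.

Lemma grad_opE {n : nat} (h : 'rV[R]_n -> 'rV[R]_s) (x y : 'rV[R]_n) i :
  differentiable (fun z => h z ord0 i) x ->
  grad_op h x y ord0 i = 'D_y (fun z => h z ord0 i) x.
Proof.
move=> dh; rewrite deriveE // [in RHS](row_sum_delta y) linear_sum /= mxE.
by apply: eq_bigr => j _; rewrite linearZ /= !mxE deriveE.
Qed.

End Orthant.

(** * The asymptotic cone of a closed convex set *)

Section AsymCone.
Context {R : realType} {n : nat} {K : set 'rV[R]_n}.
Implicit Types a v w : 'rV[R]_n.
Hypotheses (K_nonempty : K !=set0) (K_closed : closed K)
  (K_convex : convex_set K).

Let K_segment a b (t : R) : 0 <= t <= 1 -> K a -> K b ->
  K ((1 - t) *: a + t *: b).
Proof.
move=> /andP[t0 t1] Ka Kb.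
have sp : Itv.spec (@Itv.num_sem R) (Itv.Real `[0%Z, 1%Z]) t.
  by rewrite /= /Itv.num_sem /= realE t0 in_itv/= t0 t1.
have := @K_convex b a (Itv.mk sp).
rewrite !inE => /(_ Kb Ka).
by rewrite /conv /= addrC.
Qed.

(** The convex combinations of [a] and [x k] with weight [(t k)^-1] on [x k] tend to [a + v], and
    [K] is closed. Conversely, repeated translation by [v] keeps all [a + k.+1%:R *: v] in [K]. This
    form yields additivity at once, and closedness because the cone becomes an intersection of
    translates of [K]. *)
Lemma asym_coneP v : asym_cone K v <-> forall a, K a -> K (a + v).
Proof.
split=> [[t [x [ty Kx xv]]] a Ka|Kv].
  have ty0 : (t k)^-1 @[k --> \oo] --> (0 : R).
    by apply/(gtr0_cvgV0 (f := t)) => //; exact: (cvgryPgt _).1.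
  apply: (@closed_cvg _ _ \oo _
    (fun k => (1 - (t k)^-1) *: a + (t k)^-1 *: x k)) => //.
    have t1 : \forall k \near \oo, 1 <= t k by exact: (cvgryPge _).1.
    apply: filterS t1 => k tk; apply: K_segment => //.
    by rewrite invr_ge0 invf_le1 ?tk ?andbT; lra.
  apply: cvgD => //.
  rewrite -[X in _ --> X]scale1r -[in X in _ --> X](subr0 1).
  apply: cvgZ; last exact: cvg_cst.
  by apply: cvgB => //; exact: cvg_cst.
have [a Ka] := K_nonempty.
exists (fun k => k.+1%:R), (fun k => a + k.+1%:R *: v); split.
- apply/cvgryPge => M; apply: filterS (nbhs_infty_ger M) => k /= /le_trans.
  by apply; rewrite ler_nat.
- elim => [|k IH]; first by rewrite scale1r; exact: Kv.
  by rewrite -natr1 scalerDl scale1r addrA; exact: Kv.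
under eq_fun do rewrite scalerDr scalerA mulVf ?pnatr_eq0 // scale1r.
suff: k.+1%:R^-1 *: a + v @[k --> \oo] --> 0 *: a + v by rewrite scale0r add0r.
apply: cvgD; last exact: cvg_cst.
by apply: cvgZ; [exact: cvg_harmonic | exact: cvg_cst].
Qed.

Lemma asym_cone0 : asym_cone K 0.
Proof. by apply/asym_coneP => a; rewrite addr0. Qed.

Lemma asym_coneD v w : asym_cone K v -> asym_cone K w -> asym_cone K (v + w).
Proof.
move=> /asym_coneP Kv /asym_coneP Kw; apply/asym_coneP => a Ka.
by rewrite addrA; exact/Kw/Kv.
Qed.

Lemma asym_coneZ l v : 0 <= l -> asym_cone K v -> asym_cone K (l *: v).
Proof.
rewrite le0r => /predU1P[->|l0].
  by rewrite scale0r => _; exact: asym_cone0.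
(* The points stay the same; only the scaling factors are divided by [l]. *)
move=> [t [x [ty Kx xv]]]; exists (fun k => t k / l), x; split => //.
  apply/cvgryPge => A; have /cvgryPge/(_ (A * l)) := ty.
  by apply: filterS => k; rewrite ler_pdivlMr.
under eq_fun do rewrite invfM invrK mulrC -scalerA.
by apply: cvgZ => //; exact: cvg_cst.
Qed.

Lemma closed_asym_cone : closed (asym_cone K).
Proof.
have -> : asym_cone K = \bigcap_(a in K) ((fun v => a + v) @^-1` K).
  by apply/seteqP; split=> v /asym_coneP.
apply: closed_bigI => a _; apply: preimage_closed => // v _.
apply: (@continuousD _ _ _ (fun=> a) id); last exact: cvg_id.
exact: cst_continuous.
Qed.

End AsymCone.

(** * Boundedness, Euler's identity and first-order optimality *)

Lemma bounded_setP {R : realType} {V : normedModType R} (A : set V) :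
  bounded_set A <-> exists M, forall x, A x -> `|x| <= M.
Proof.
split=> [bA|[M AM]].
  have {}bA : \forall M \near +oo, forall x, A x -> `|x| <= M := bA.
  by have [M AM] := filter_ex bA; exists M.
by apply: filterS (nbhs_pinfty_ge (num_real M)) => B MB x /AM /le_trans; apply.
Qed.

(** Euler's identity: along the line through 0 and [x], [g] is the function [l ^+ d * g x] of [l],
    which is differentiated at [l = 1]. *)
Lemma derive_homogeneous {R : realType} {n : nat} (g : 'rV[R]_n -> R) (d : nat)
    (x : 'rV[R]_n) :
  (forall l, g (l *: x) = l ^+ d * g x) -> 'D_x g x = d%:R * g x.
Proof.
move=> gZ.
have -> : 'D_x g x = 'D_1 (g x \*: (id ^+ d : R -> R)) 1.
  rewrite /derive; set q := (fun _ : R => _); set q' := (fun _ : R => _).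
  suff -> : q = q' by [].
  apply/funext => h; rewrite /q /q' /=; congr (_ *: _).
  rewrite -[X in g (_ + X)]scale1r -scalerDl gZ.
  by rewrite !exprfctE /= expr1n /GRing.scale /= !mulr1 mulrC.
by rewrite derive_val /GRing.scale /= expr1n !mulr1 mulrC.
Qed.

(** Were all these derivatives negative, each component would decrease strictly for small [t > 0].
    There are finitely many components, so one [t] serves them all, and [t *: u + x] strictly
    dominates [x]. *)
Lemma SOLw_first_order {R : realType} {n s : nat} (C : set 'rV[R]_n)
    (h : 'rV[R]_n -> 'rV[R]_s) (x u : 'rV[R]_n) :
  (forall i, derivable (fun z => h z ord0 i) x u) ->
  (forall t, 0 <= t <= 1 -> C (t *: u + x)) -> SOLw C h x ->
  exists i, 0 <= 'D_u (fun z => h z ord0 i) x.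
Proof.
move=> dh Cxu /SOLwP[Cx opt]; apply/not_existsP => D0.
have decr i : \forall t \near 0^'+, h (t *: u + x) ord0 i < h x ord0 i.
  have Dlt : 'D_u (fun z => h z ord0 i) x < 0 by rewrite ltNge; apply/negP/D0.
  have quo := cvgr_lt _ (cvg_dnbhs_at_right (dh i)) _ Dlt.
  near=> t; have t0 : 0 < t by near: t; exact: nbhs_right_gt.
  have : t^-1 *: (h (t *: u + x) ord0 i - h x ord0 i) < 0.
    by near: t; exact: quo.
  by rewrite /GRing.scale /= pmulr_rlt0 ?invr_gt0 // subr_lt0.
have : \forall t \near (0 : R)^'+, False.
  near=> t.
  have t0 : 0 < t by near: t; exact: nbhs_right_gt.
  have t1 : t < 1 by near: t; exact: nbhs_right_lt.
  have t01 : 0 <= t <= 1 by rewrite !ltW.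
  have [i] := opt _ (Cxu t t01); apply/negP; rewrite -ltNge; move: i.
  by near: t; exact: filter_forall.
by move=> /filter_ex[].
Unshelve. all: by end_near. Qed.

(** * Leading forms on a closed convex cone: optimality and complementarity *)

Section Vpinfty.
Context {R : realType} {n s : nat} {f : 'I_s -> mpoly n R}.
Implicit Types x y v : 'rV[R]_n.

Lemma vpinftyE i : (fun z => vpinfty f z ord0 i) = lead_form (f i).
Proof. by apply/funext => z; rewrite mxE pinfty_lead_form. Qed.

Lemma grad_op_vpinfty x y i :
  grad_op (vpinfty f) x y ord0 i = 'D_y (lead_form (f i)) x.
Proof.
by rewrite grad_opE vpinftyE //; exact: differentiable_lead_form.
Qed.

Lemma continuous_lead_form i : continuous (lead_form (f i)).
Proof.
by move=> x; apply: differentiable_continuous; exact: differentiable_lead_form.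
Qed.

Lemma SOLw_vpinftyP (C : set 'rV[R]_n) x :
  SOLw C (vpinfty f) x <->
  C x /\ forall y, C y -> exists i, lead_form (f i) x <= lead_form (f i) y.
Proof.
rewrite SOLwP; split=> -[Cx opt]; split=> // y /opt[i le];
  by exists i; move: le; rewrite !mxE !pinfty_lead_form.
Qed.

Hypothesis f_deg : forall i, (1 <= pdeg (f i))%N.

Lemma lead_form0 i : lead_form (f i) 0 = 0.
Proof.
rewrite -(scale0r 0) lead_formZ expr0n.
by case: pdeg (f_deg i) => //= *; rewrite mul0r.
Qed.

Section Cone.
Context {C : set 'rV[R]_n}.
Hypotheses (C_closed : closed C)
  (CD : forall x y, C x -> C y -> C (x + y))
  (CZ : forall l x, 0 <= l -> C x -> C (l *: x)).

Lemma SOLw_sub_WVCP : SOLw C (vpinfty f) `<=` WVCP C (grad_op (vpinfty f)).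
Proof.
move=> x sol; have [Cx _] := (SOLwP _ _ _).1 sol.
have foc u : (forall t, 0 <= t <= 1 -> C (t *: u + x)) ->
    exists i, 0 <= 'D_u (lead_form (f i)) x.
  move=> Cxu; have [|i] := SOLw_first_order _ Cxu sol; last first.
    by rewrite vpinftyE; exists i.
  move=> i; rewrite vpinftyE.
  by apply/diff_derivable; exact: differentiable_lead_form.
split=> // [y Cy /opp_int_orthantP y0|/int_orthantP x0].
  have [|i] := foc y; first by move=> t /andP[t0 _]; apply: CD => //; exact: CZ.
  by apply/negP; rewrite -ltNge -grad_op_vpinfty.
(* The segment from [x] to 0 consists of the points [(1 - t) *: x], which lie in the cone. *)
have [|i] := foc (- x).
  move=> t /andP[_ t1]; rewrite scalerN addrC -[X in X - _]scale1r -scalerBl.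
  by apply: CZ; rewrite // subr_ge0.
have := x0 i; rewrite grad_op_vpinfty !deriveE ?linearN;
  by [lra | exact: differentiable_lead_form].
Qed.

Hypothesis sol0 : SOLw C (vpinfty f) = [set 0].

(** Otherwise every form is at [x] at most its value 0 at the origin, and [x] inherits weak
    optimality from 0. *)
Lemma lead_form_pos x : C x -> x != 0 -> exists i, 0 < lead_form (f i) x.
Proof.
move=> Cx x0; apply/not_existsP => xle.
have /SOLw_vpinftyP[_ opt] : SOLw C (vpinfty f) 0 by rewrite sol0.
have : SOLw C (vpinfty f) x.
  apply/SOLw_vpinftyP; split => // y /opt[i le0]; exists i.
  by apply: le_trans le0; rewrite lead_form0 leNgt; apply/negP/xle.
by rewrite sol0 /=; apply/eqP.
Qed.

(** Each summand is twice the positive part of a form, so by [lead_form_pos] the sum is positive on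
    the compact unit sphere of [C], and its minimum there serves as [m]. *)
Lemma lead_form_sphere : exists2 m : R, 0 < m &
  forall v, C v -> `|v| = 1 ->
    m <= \sum_i (`|lead_form (f i) v| + lead_form (f i) v).
Proof.
pose S := C `&` [set v | `|v| = 1].
have [S0|/set0P Sne] := eqVneq S set0.
  by exists 1 => // v Cv v1; have : S v by []; rewrite S0.
have Scompact : compact S.
  apply: bounded_closed_compact.
    by apply/bounded_setP; exists 1 => v [_ /= ->].
  apply: closedI => //.
  apply: (@preimage_closed _ _ (fun v : 'rV[R]_n => `|v|) [set 1]).
    by move=> v _; exact: norm_continuous.
  exact: closed_eq.
pose phi v := \sum_i (`|lead_form (f i) v| + lead_form (f i) v).
have phi_cont : continuous phi.
  apply: continuous_big => [|i _ v]; first exact: add_continuous.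
  apply: (@continuousD _ _ _ (fun w => `|lead_form (f i) w|)); last first.
    exact: continuous_lead_form.
  apply: continuous_comp; first exact: continuous_lead_form.
  exact: norm_continuous.
have [c /set_mem[Cc c1] cmin] :=
  EVT_min_rV Sne Scompact (continuous_subspaceT phi_cont).
exists (phi c) => [|v Cv v1]; last by apply: cmin; rewrite inE.
have c0 : c != 0.
  by apply: contra_eqN c1 => /eqP->; rewrite normr0 eq_sym oner_eq0.
have [i ci] := lead_form_pos Cc c0.
rewrite /phi (bigD1 i) //= ltr_wpDr //; last by rewrite gtr0_norm // addr_gt0.
apply: sumr_ge0 => j _; have := ler_norm (- lead_form (f j) c).
by rewrite normrN; lra.
Qed.

(** Rescale [y] of norm above 1 to the sphere. As the degrees are at least 1, each doubled positive
    part becomes at most [2 M / |y|], whence [m <= s * 2 M / |y|], which bounds [|y|]. *)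
Lemma bounded_lead_form_sublevel (M : R) :
  bounded_set [set y | C y /\ forall i, lead_form (f i) y <= M].
Proof.
wlog M0 : M / 0 <= M.
  move=> H; apply/bounded_setP.
  have /bounded_setP[B yB] := H `|M| (normr_ge0 _).
  exists B => y [Cy yM]; apply: yB; split=> // i.
  exact: le_trans (ler_norm _).
have [m m0 mle] := lead_form_sphere.
apply/bounded_setP; exists (1 + (s%:R * (M *+ 2)) / m) => y [Cy yM].
have B0 : 0 <= s%:R * (M *+ 2) / m.
  by apply: divr_ge0; [rewrite mulr_ge0 ?mulrn_wge0 | exact: ltW].
have [y1|/ltW y1] := leP `|y| 1; first by rewrite (le_trans y1) // lerDl.
rewrite (@le_trans _ _ (s%:R * (M *+ 2) / m)) ?lerDr //.
have y0 : 0 < `|y| by exact: lt_le_trans y1.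
rewrite ler_pdivlMr // mulrC -ler_pdivlMr //.
apply: (le_trans (mle (`|y|^-1 *: y) _ _)).
- by apply: CZ; rewrite // invr_ge0.
- by rewrite normrZ gtr0_norm ?invr_gt0 // mulVf ?gt_eqF.
rewrite -mulrA -[X in X%:R * _](card_ord s) mulr_natl -sumr_const.
apply: ler_sum => i _; rewrite lead_formZ.
have e0 : 0 <= `|y|^-1 ^+ pdeg (f i) by rewrite exprn_ge0 ?invr_ge0.
have e1 : `|y|^-1 ^+ pdeg (f i) <= `|y|^-1.
  case: pdeg (f_deg i) => // d _; rewrite exprS ler_piMr ?invr_ge0 //.
  by rewrite exprn_ile1 ?invr_ge0 // invf_le1.
have yMi := yM i.
have [neg|pos] := leP (lead_form (f i) y) 0.
  by rewrite ler0_norm ?mulr_ge0_le0 // addNr divr_ge0 ?mulrn_wge0 //.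
have : `|y|^-1 ^+ pdeg (f i) * lead_form (f i) y <= M / `|y|.
  by rewrite [leRHS]mulrC ler_pM // ltW.
move=> le; rewrite ger0_norm; last by rewrite mulr_ge0 // ltW.
by rewrite mulrnAl mulr2n lerD.
Qed.

Lemma lead_form_all_pos x i : C x -> x != 0 -> 0 < lead_form (f i) x.
Proof.
move=> Cx x0; rewrite ltNge; apply/negP => xi.
have [z Cz zx] : exists2 z, C z &
    forall j, lead_form (f j) z < lead_form (f j) x.
  apply: contrapT => nz; have : SOLw C (vpinfty f) x.
    apply/SOLw_vpinftyP; split => // y Cy; apply/not_existsP => lt.
    by apply: nz; exists y => // j; rewrite ltNge; apply/negP/lt.
  by rewrite sol0 => /= x00; move: x0; rewrite x00 eqxx.
pose A := [set y | C y /\ forall j, lead_form (f j) y <= lead_form (f j) z].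
have Abnd : bounded_set A.
  apply/bounded_setP.
  (* A single bound for all components: the sum dominates each [lead_form (f j) z]. *)
  have /bounded_setP[B yB] :=
    bounded_lead_form_sublevel (\sum_j `|lead_form (f j) z|).
  exists B => y [Cy yz]; apply: yB; split=> // j; apply: (le_trans (yz j)).
  by rewrite (bigD1 j) //= (le_trans (ler_norm _)) // lerDl sumr_ge0.
have Acl : closed A.
  have -> : A = C `&` \bigcap_(j in setT)
      (lead_form (f j) @^-1` [set r | r <= lead_form (f j) z]).
    by apply/seteqP; split=> y [Cy yz]; split=> // j; [move=> _|]; exact: yz.
  apply: closedI => //; apply: closed_bigI => j _; apply: preimage_closed.
    by move=> y _; exact: continuous_lead_form.
  exact: closed_le.
have A0 : A !=set0 by exists z.
have [c /set_mem[Cc cz] cmin] := EVT_min_rV A0 (bounded_closed_compact Abnd Acl)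
  (continuous_subspaceT (@continuous_lead_form i)).
(* A strict dominator of [c] would again lie in [A], with a smaller value of the form [i] that [c]
   minimizes. *)
have : SOLw C (vpinfty f) c.
  apply/SOLw_vpinftyP; split => // y Cy; apply/not_existsP => lt.
  have yc j : lead_form (f j) y < lead_form (f j) c.
    by rewrite ltNge; apply/negP/lt.
  suff /mem_set/cmin : A y by rewrite leNgt yc.
  by split=> // j; exact: le_trans (ltW (yc j)) (cz j).
(* Now [c = 0], so form [i] is nonnegative at [z] and hence positive at [x], against [xi]. *)
rewrite sol0 /= => c0; have := cz i; rewrite c0 lead_form0.
by have := zx i; lra.
Qed.

Lemma WVCP_sub0 : WVCP C (grad_op (vpinfty f)) `<=` [set 0].
Proof.
move=> x [Cx _ xx] /=; have [//|x0] := eqVneq x 0; exfalso; apply: xx.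
apply/int_orthantP => i; rewrite grad_op_vpinfty.
rewrite (@derive_homogeneous _ _ _ (pdeg (f i))) => [|l];
  last exact: lead_formZ.
by rewrite mulr_gt0 ?ltr0n //; exact: lead_form_all_pos.
Qed.

End Cone.
End Vpinfty.

Unset Implicit Arguments.
Set Strict Implicit.

Theorem theorem3p2 (R : realType) (n s : nat) (K : set 'rV[R]_n)
    (f : 'I_s -> mpoly n R)
    (K_nonempty : K !=set0) (K_closed : closed K) (K_convex : convex_set K)
    (f_deg : forall i, (1 <= pdeg (f i))%N) :
  (SOLw (asym_cone K) (vpinfty f) = [set 0] ->
     type_R0 (asym_cone K) (grad_op (vpinfty f))) /\
  (type_R0 (asym_cone K) (grad_op (vpinfty f)) ->
     strongly_regular K f).
Proof.
have sub : SOLw (asym_cone K) (vpinfty f)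
    `<=` WVCP (asym_cone K) (grad_op (vpinfty f)).
  by apply: SOLw_sub_WVCP; [exact: asym_coneD | exact: asym_coneZ].
split=> [sol0|R0].
  (* That 0 solves the complementarity problem is the inclusion [sub] applied to the weak Pareto
     point 0. *)
  apply/seteqP; split; last by rewrite -sol0.
  apply: WVCP_sub0 => //; [exact: closed_asym_cone | exact: asym_coneZ].
by apply/bounded_setP; exists 0 => x /sub; rewrite R0 => /= ->; rewrite normr0.
Qed.
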